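(* Let $\mathcal{O}_q(G/L_S)$ be an irreducible quantum flag manifold, with associated $(0,1)$-Heckenberger--Kolb calculus $(\Omega_q^{(0,1)}(G/L_S),\overline{\partial})$. Then $$H^0_q(G/L_S):=\ker\left(\overline{\partial}:\mathcal{O}_q(G/L_S)\to\Omega^{(0,1)}_q(G/L_S)\right)=\mathbb{C}1.$$
   Context: Quantum groups. Let $\mathfrak{g}$ be a finite-dimensional complex simple Lie algebra of rank $l$ with Cartan subalgebra $\mathfrak{h}$, simple roots $\Pi=\{\alpha_1,\dots,\alpha_l\}$, positive roots $R^+$, Weyl group with longest element $w_0$, and form $(\cdot,\cdot)$ on $\mathfrak{h}^*$ normalised so that shortest simple roots satisfy $(\alpha_i,\alpha_i)=2$. Put $\alpha_i^\vee=2\alpha_i/(\alpha_i,\alpha_i)$, $a_{ij}=(\alpha_i^\vee,\alpha_j)$; let $\mathcal{P}^+$ be the dominant integral weights. Fix $q\in\mathbb{R}\setminus\{-1,0,1\}$ and $q_i=q^{(\alpha_i,\alpha_i)/2}$. $U_q(\mathfrak{g})$ is the Hopf algebra generated by $E_i,F_i,K_i^{\pm1}$ with $K_iK_j=K_jK_i$, $K_iE_j=q_i^{a_{ij}}E_jK_i$, $K_iF_j=q_i^{-a_{ij}}F_jK_i$, $E_iF_j-F_jE_i=\delta_{ij}(K_i-K_i^{-1})/(q_i-q_i^{-1})$, the quantum Serre relations, $\Delta(K_i)=K_i\otimes K_i$, $\Delta(E_i)=E_i\otimes K_i+1\otimes E_i$, $\Delta(F_i)=F_i\otimes1+K_i^{-1}\otimes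 F_i$, $\varepsilon(E_i)=\varepsilon(F_i)=0$, $\varepsilon(K_i)=1$. For $\lambda\in\mathcal{P}^+$, $V_\lambda$ is the finite-dimensional irreducible (type-1) left module generated by a vector $v$ with $E_iv=0$ and $K_iv=q^{(\alpha_i,\lambda)}v$ for all $i$. For $v\in V_\lambda$, $f\in V_\lambda^*$ set $c^{\lambda}_{f,v}(X)=f(Xv)$, $X\in U_q(\mathfrak{g})$. $\mathcal{O}_q(G)\subseteq U_q(\mathfrak{g})^\circ$ is the Hopf subalgebra spanned by all $c^{\lambda}_{f,v}$, $\lambda\in\mathcal{P}^+$. It carries the left action $X\triangleright a=a_{(1)}a_{(2)}(X)$ and the right action $a\triangleleft X=a_{(1)}(X)a_{(2)}$ of $U_q(\mathfrak{g})$. Irreducible quantum flag manifolds. For $S\subseteq\Pi$, $U_q(\mathfrak{l}_S)$ is the subalgebra generated by all $K_i^{\pm1}$ and by $E_j,F_j$ for $\alpha_j\in S$. Set $\mathcal{O}_q(G/L_S)=\{b\in\mathcal{O}_q(G): X\triangleright b=\varepsilon(X)b\ \forall X\in U_q(\mathfrak{l}_S)\}$. The quantum flag manifold is irreducible when $S=\Pi\setminus\{\alpha_x\}$ with $\alpha_x$ of coefficient $1$ in the highest root (up to diagram automorphism: any node of $A_n$; the first node of $B_n$; the last node of $C_n$; the first node or a spin node of $D_n$; an end node of a long leg of $E_6$; the end node $7$ of $E_7$). The $(0,1)$-Heckenberger--Kolb calculus. A first-order differential calculus (fodc) over an algebra $B$ is a $B$-bimodule $\Omega^1$ with a derivation $\mathrm{d}:B\to\Omega^1$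 such that $\Omega^1$ is generated as a left module by $\mathrm{d}B$. Let $B=\mathcal{O}_q(G/L_S)$, $B^+=\ker(\varepsilon|_B)$, $K=U_q(\mathfrak{l}_S)$. Let $T^{(0,1)}$ be the span of the functionals on $B$ given by evaluation on the Lusztig quantum root vectors $E_\beta$, $\beta\in R^+\setminus\mathbb{Z}S$, the underlying reduced decomposition of $w_0$ being such that $T^{(0,1)}$ is stable under left multiplication by $K$; explicitly, $T^{(0,1)}$ is the space of functionals induced by $U_q(\mathfrak{l}_S)E_x$. Put $I=\{b\in B^+: X(b)=0\ \forall X\in T^{(0,1)}\}$ and $V=B^+/I$, a right $B$-module and a right $K$-module via $\triangleleft$. Then $\Omega^{(0,1)}_q(G/L_S)$ consists of the $\sum_i a_i\otimes v_i\in\mathcal{O}_q(G)\otimes V$ with $\sum_i(Y\triangleright a_i)\otimes v_i=\sum_i a_i\otimes(v_i\triangleleft Y)$ for all $Y\in K$, with left $B$-action on the first factor, right action $(a\otimes v)b=ab_{(1)}\otimes vb_{(2)}$, and $\overline{\partial}b=b_{(1)}\otimes[b_{(2)}-\varepsilon(b_{(2)})1]$. If $X_1,\dots,X_n$ is a basis of $T^{(0,1)}$ and $e_1,\dots,e_n$ the dual basis of $V$, then $\overline{\partial}b=\sum_i(X_i\triangleright b)\otimes e_i$, where $X_i\triangleright b=b_{(1)}X_i(b_{(2)})$. *)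

(* Defs.v *)
From HB Require Import structures.
From mathcomp Require Import all_boot all_order all_algebra.
From mathcomp Require Import all_classical all_reals.
From mathcomp Require Import complex.

Set Implicit Arguments.
Unset Strict Implicit.
Unset Printing Implicit Defensive.

Import Order.TTheory GRing.Theory Num.Theory.

Local Open Scope ring_scope.
Local Open Scope quotient_scope.

(** * Subspaces and quotients of (possibly infinite-dimensional) vector spaces *)

Record subspace (K : fieldType) (V : lmodType K) := Subspace {
  smem :> V -> Prop;
  smem0 : smem 0;
  smemP : forall c x y, smem x -> smem y -> smem (c *: x + y)
}.

Section SubspaceType.
Variables (K : fieldType) (V : lmodType K) (W : subspace V).

Definition smemb : pred V := fun x => `[< W x >].

Lemma smemb_closed : submod_closed smemb.
Proof.
split; first exact/asboolP/smem0.
by move=> c x y /asboolP Wx /asboolP Wy; apply/asboolP/smemP.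
Qed.

HB.instance Definition _ := GRing.isSubmodClosed.Build K V smemb smemb_closed.

Record subty := Subty { subval : V; _ : smemb subval }.

HB.instance Definition _ := [isSub for subval].
HB.instance Definition _ := [Choice of subty by <:].
HB.instance Definition _ := [SubChoice_isSubLmodule of subty by <:].

Definition mksub x (Wx : W x) : subty := Subty (asboolT Wx).

Lemma subvalP (x : subty) : W (subval x).
Proof. by case: x => y Wy; apply/asboolP. Qed.

Lemma subval_inj : injective subval.
Proof. exact: val_inj. Qed.

Lemma subval_is_linear : linear subval.
Proof. by move=> c x y; rewrite -[subval]/val linearP. Qed.

HB.instance Definition _ := GRing.isLinear.Build K subty V _ subval subval_is_linear.
End SubspaceType.

Coercion subty : subspace >-> Sortclass.

Section Span.
Variables (K : fieldType) (V : lmodType K) (A : V -> Prop).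

Inductive in_lspan : V -> Prop :=
| lspan0 : in_lspan 0
| lspanD c x y : A x -> in_lspan y -> in_lspan (c *: x + y).

Lemma lspanP c x y : in_lspan x -> in_lspan y -> in_lspan (c *: x + y).
Proof.
move=> + sy; elim=> [|d u v Au _ IH]; first by rewrite scaler0 add0r.
by rewrite scalerDr scalerA -addrA; apply: lspanD.
Qed.

Definition lspan : subspace V := Subspace lspan0 lspanP.

Lemma lspan_gen x : A x -> lspan x.
Proof. by move=> Ax; rewrite -[x]addr0 -[x]scale1r; apply: lspanD => //; left. Qed.
End Span.

Section QuotientSpace.
Variables (K : fieldType) (V : lmodType K) (W : subspace V).

Definition quot_rel (x y : V) : bool := `[< W (x - y) >].

Lemma smemN x : W x -> W (- x).
Proof. by move=> Wx; rewrite -[- x]addr0 -scaleN1r; apply: smemP => //; exact: smem0. Qed.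

Lemma smemD x y : W x -> W y -> W (x + y).
Proof. by move=> Wx Wy; rewrite -[x]scale1r; apply: smemP. Qed.

Lemma quot_rel_equiv : equiv_class_of quot_rel.
Proof.
split=> [x|x y|y x z]; first by apply/asboolP; rewrite subrr; exact: smem0.
  by apply/asboolP/asboolP => /smemN; rewrite opprB.
move=> /asboolP xy /asboolP yz; apply/asboolP.
by rewrite -(subrKA y); apply: smemD.
Qed.

Canonical quot_equiv := EquivRelPack quot_rel_equiv.

Definition quotsp := {eq_quot quot_rel}.
HB.instance Definition _ := Choice.on quotsp.
HB.instance Definition _ : EqQuotient V quot_rel quotsp := EqQuotient.on quotsp.

Definition qclass (x : V) : quotsp := \pi_quotsp x.

Lemma qclass_eq x y : W (x - y) <-> qclass x = qclass y.
Proof.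
split=> [h|/eqP]; first by apply/eqmodP/asboolP.
by rewrite eqmodE => /asboolP.
Qed.

Lemma qclassK x : qclass (repr x) = x.
Proof. exact: reprK. Qed.

Lemma repr_qclass x : W (repr (qclass x) - x).
Proof. by apply/qclass_eq; rewrite qclassK. Qed.

Definition q_add (x y : quotsp) := qclass (repr x + repr y).
Definition q_opp (x : quotsp) := qclass (- repr x).
Definition q_scale c (x : quotsp) := qclass (c *: repr x).

Lemma smemZ c x : W x -> W (c *: x).
Proof. by move=> Wx; rewrite -[_ *: _]addr0; apply: smemP => //; exact: smem0. Qed.

Lemma qaddE x y : q_add (qclass x) (qclass y) = qclass (x + y).
Proof.
by apply/qclass_eq; rewrite opprD addrACA; apply: smemD; exact: repr_qclass.
Qed.

Lemma qoppE x : q_opp (qclass x) = qclass (- x).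
Proof. by apply/qclass_eq; rewrite -opprD; apply: smemN; exact: repr_qclass. Qed.

Lemma qscaleE c x : q_scale c (qclass x) = qclass (c *: x).
Proof. by apply/qclass_eq; rewrite -scalerBr; apply: smemZ; exact: repr_qclass. Qed.

Lemma qind (P : quotsp -> Prop) : (forall x, P (qclass x)) -> forall x, P x.
Proof. by move=> h x; rewrite -[x]qclassK. Qed.

Fact q_addA : associative q_add.
Proof. by do 3![elim/qind=> ?]; rewrite !qaddE addrA. Qed.
Fact q_addC : commutative q_add.
Proof. by do 2![elim/qind=> ?]; rewrite !qaddE addrC. Qed.
Fact q_add0 : left_id (qclass 0) q_add.
Proof. by elim/qind=> ?; rewrite !qaddE add0r. Qed.
Fact q_addN : left_inverse (qclass 0) q_opp q_add.
Proof. by elim/qind=> ?; rewrite !qoppE !qaddE addNr. Qed.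

HB.instance Definition _ := GRing.isZmodule.Build quotsp q_addA q_addC q_add0 q_addN.

Lemma qclassD x y : qclass (x + y) = qclass x + qclass y.
Proof. exact/esym/qaddE. Qed.

Fact q_scaleA c d x : q_scale c (q_scale d x) = q_scale (c * d) x.
Proof. by elim/qind: x => x; rewrite !qscaleE scalerA. Qed.
Fact q_scale1 : left_id 1 q_scale.
Proof. by elim/qind=> x; rewrite qscaleE scale1r. Qed.
Fact q_scaleDr : right_distributive q_scale +%R.
Proof. by move=> c; do 2![elim/qind=> ?]; rewrite -qclassD !qscaleE scalerDr qclassD. Qed.
Fact q_scaleDl x : {morph q_scale^~ x : c d / c + d}.
Proof. by move=> c d; elim/qind: x => x; rewrite !qscaleE scalerDl qclassD. Qed.

HB.instance Definition _ := GRing.Zmodule_isLmodule.Build K quotsp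
  q_scaleA q_scale1 q_scaleDr q_scaleDl.

Lemma qclassZ c x : qclass (c *: x) = c *: qclass x.
Proof. exact/esym/qscaleE. Qed.

Lemma qclass_is_linear : linear qclass.
Proof. by move=> c x y; rewrite qclassD qclassZ. Qed.

HB.instance Definition _ := GRing.isLinear.Build K V quotsp _ qclass qclass_is_linear.

(* Induced map: meaningful when f : V -> Z is linear and kills W (qliftE). *)
Definition qlift (Z : Type) (f : V -> Z) (x : quotsp) : Z := f (repr x).

Lemma qliftE (Z : lmodType K) (f : {linear V -> Z}) (x : V) :
  (forall w, W w -> f w = 0) -> qlift f (qclass x) = f x.
Proof.
move=> fW; apply/eqP; rewrite -subr_eq0 -linearB; apply/eqP/fW.
exact: repr_qclass.
Qed.
End QuotientSpace.

(** * Tensor product of two vector spaces *)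

Section Tensor.
Variables (K : fieldType) (V W : lmodType K).

(* The space generated by the symbols v (x) w subject to bilinearity: formal
   expressions modulo the congruence generated by the vector space axioms and
   the bilinearity relations. *)
Inductive texpr :=
| TPure of V & W | TZero | TOpp of texpr | TAdd of texpr & texpr
| TScale of K & texpr.

Inductive teq : texpr -> texpr -> Prop :=
| teq_refl s : teq s s
| teq_sym s t : teq s t -> teq t s
| teq_trans s t u : teq s t -> teq t u -> teq s u
| teq_opp s s' : teq s s' -> teq (TOpp s) (TOpp s')
| teq_add s s' t t' : teq s s' -> teq t t' -> teq (TAdd s t) (TAdd s' t')
| teq_scale c s s' : teq s s' -> teq (TScale c s) (TScale c s')
| teq_addA s t u : teq (TAdd s (TAdd t u)) (TAdd (TAdd s t) u)
| teq_addC s t : teq (TAdd s t) (TAdd t s)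
| teq_add0 s : teq (TAdd TZero s) s
| teq_addN s : teq (TAdd (TOpp s) s) TZero
| teq_scaleA c d s : teq (TScale c (TScale d s)) (TScale (c * d) s)
| teq_scale1 s : teq (TScale 1 s) s
| teq_scaleDr c s t : teq (TScale c (TAdd s t)) (TAdd (TScale c s) (TScale c t))
| teq_scaleDl c d s : teq (TScale (c + d) s) (TAdd (TScale c s) (TScale d s))
| teq_pureDl v v' w : teq (TPure (v + v') w) (TAdd (TPure v w) (TPure v' w))
| teq_pureDr v w w' : teq (TPure v (w + w')) (TAdd (TPure v w) (TPure v w'))
| teq_pureZl c v w : teq (TPure (c *: v) w) (TScale c (TPure v w))
| teq_pureZr c v w : teq (TPure v (c *: w)) (TScale c (TPure v w)).

HB.instance Definition _ := gen_eqMixin texpr.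
HB.instance Definition _ := gen_choiceMixin texpr.

Definition teqb s t : bool := `[< teq s t >].

Lemma teqb_equiv : equiv_class_of teqb.
Proof.
split=> [s|s t|t s u]; first by apply/asboolP; constructor.
  by apply/asboolP/asboolP; apply: teq_sym.
by move=> /asboolP st /asboolP tu; apply/asboolP; apply: teq_trans tu.
Qed.

Canonical teqb_equivRel := EquivRelPack teqb_equiv.

Definition tensor := {eq_quot teqb}.
HB.instance Definition _ := Choice.on tensor.
HB.instance Definition _ : EqQuotient texpr teqb tensor := EqQuotient.on tensor.

Definition tclass (s : texpr) : tensor := \pi_tensor s.

Lemma tclass_eq s t : teq s t <-> tclass s = tclass t.
Proof.
split=> [h|/eqP]; first by apply/eqmodP/asboolP.
by rewrite eqmodE => /asboolP.
Qed.

Lemma tclassK x : tclass (repr x) = x.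
Proof. exact: reprK. Qed.

Lemma repr_tclass s : teq (repr (tclass s)) s.
Proof. by apply/tclass_eq; rewrite tclassK. Qed.

Definition t_add (x y : tensor) := tclass (TAdd (repr x) (repr y)).
Definition t_opp (x : tensor) := tclass (TOpp (repr x)).
Definition t_scale c (x : tensor) := tclass (TScale c (repr x)).

Lemma taddE s t : t_add (tclass s) (tclass t) = tclass (TAdd s t).
Proof. by apply/tclass_eq/teq_add; exact: repr_tclass. Qed.
Lemma toppE s : t_opp (tclass s) = tclass (TOpp s).
Proof. by apply/tclass_eq/teq_opp/repr_tclass. Qed.
Lemma tscaleE c s : t_scale c (tclass s) = tclass (TScale c s).
Proof. by apply/tclass_eq/teq_scale/repr_tclass. Qed.

Lemma tind (P : tensor -> Prop) : (forall s, P (tclass s)) -> forall x, P x.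
Proof. by move=> h x; rewrite -[x]tclassK. Qed.

Fact t_addA : associative t_add.
Proof. do 3![elim/tind=> ?]; rewrite !taddE; exact/tclass_eq/teq_addA. Qed.
Fact t_addC : commutative t_add.
Proof. do 2![elim/tind=> ?]; rewrite !taddE; exact/tclass_eq/teq_addC. Qed.
Fact t_add0 : left_id (tclass TZero) t_add.
Proof. elim/tind=> ?; rewrite !taddE; exact/tclass_eq/teq_add0. Qed.
Fact t_addN : left_inverse (tclass TZero) t_opp t_add.
Proof. elim/tind=> ?; rewrite !toppE !taddE; exact/tclass_eq/teq_addN. Qed.

HB.instance Definition _ := GRing.isZmodule.Build tensor t_addA t_addC t_add0 t_addN.

Lemma tclassD s t : tclass (TAdd s t) = tclass s + tclass t.
Proof. exact/esym/taddE. Qed.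
Lemma tclassN s : tclass (TOpp s) = - tclass s.
Proof. exact/esym/toppE. Qed.
Lemma tclass0 : tclass TZero = 0.
Proof. by []. Qed.

Fact t_scaleA c d x : t_scale c (t_scale d x) = t_scale (c * d) x.
Proof. elim/tind: x => s; rewrite !tscaleE; exact/tclass_eq/teq_scaleA. Qed.
Fact t_scale1 : left_id 1 t_scale.
Proof. elim/tind=> s; rewrite !tscaleE; exact/tclass_eq/teq_scale1. Qed.
Fact t_scaleDr : right_distributive t_scale +%R.
Proof.
move=> c; do 2![elim/tind=> ?]; rewrite -tclassD !tscaleE -tclassD.
exact/tclass_eq/teq_scaleDr.
Qed.
Fact t_scaleDl x : {morph t_scale^~ x : c d / c + d}.
Proof.
move=> c d; elim/tind: x => s; rewrite !tscaleE -tclassD.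
exact/tclass_eq/teq_scaleDl.
Qed.

HB.instance Definition _ := GRing.Zmodule_isLmodule.Build K tensor
  t_scaleA t_scale1 t_scaleDr t_scaleDl.

Lemma tclassZ c s : tclass (TScale c s) = c *: tclass s.
Proof. exact/esym/tscaleE. Qed.

Definition tpure (v : V) (w : W) : tensor := tclass (TPure v w).

Lemma tpureDl v v' w : tpure (v + v') w = tpure v w + tpure v' w.
Proof. rewrite -tclassD; exact/tclass_eq/teq_pureDl. Qed.
Lemma tpureDr v w w' : tpure v (w + w') = tpure v w + tpure v w'.
Proof. rewrite -tclassD; exact/tclass_eq/teq_pureDr. Qed.
Lemma tpureZl c v w : tpure (c *: v) w = c *: tpure v w.
Proof. rewrite -tclassZ; exact/tclass_eq/teq_pureZl. Qed.
Lemma tpureZr c v w : tpure v (c *: w) = c *: tpure v w.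
Proof. rewrite -tclassZ; exact/tclass_eq/teq_pureZr. Qed.

Lemma tpure0r v : tpure v 0 = 0.
Proof. by rewrite -[0 in LHS](scale0r 0) tpureZr scale0r. Qed.

Lemma tensor_ind (P : tensor -> Prop) :
  P 0 -> (forall c v w t, P t -> P (c *: tpure v w + t)) -> forall t, P t.
Proof.
move=> P0 PD; have PD' s t : P t -> forall c, P (c *: tclass s + t).
  elim: s t => [v w|| s IH | s IHs u IHu | d s IH] t Pt c.
  - exact: PD.
  - by rewrite tclass0 scaler0 add0r.
  - by rewrite tclassN scalerN -scaleNr; apply: IH.
  - by rewrite tclassD scalerDr -addrA; apply/IHs/IHu.
  - by rewrite tclassZ scalerA; apply: IH.
by elim/tind=> s; rewrite -[tclass s]addr0 -[tclass s]scale1r; apply: PD'.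
Qed.

(* Universal property; tlift is meaningful for bilinear phi. *)
Section Lift.
Variables (Z : lmodType K) (phi : V -> W -> Z).

Fixpoint teval s : Z :=
  match s with
  | TPure v w => phi v w
  | TZero => 0
  | TOpp s => - teval s
  | TAdd s t => teval s + teval t
  | TScale c s => c *: teval s
  end.

Definition tlift (t : tensor) : Z := teval (repr t).

Hypothesis phil : forall w, linear (phi^~ w).
Hypothesis phir : forall v, linear (phi v).

Lemma teval_eq s t : teq s t -> teval s = teval t.
Proof.
elim=> //=; try by move=> *; congruence.
- by move=> *; rewrite addrA.
- by move=> *; rewrite addrC.
- by move=> *; rewrite add0r.
- by move=> *; rewrite addNr.
- by move=> *; rewrite scalerA.
- by move=> *; rewrite scale1r.
- by move=> *; rewrite scalerDr.
- by move=> *; rewrite scalerDl.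
- by move=> v v' w; move: (phil w 1 v v'); rewrite !scale1r.
- by move=> v w w'; move: (phir v 1 w w'); rewrite !scale1r.
- move=> c v w; have h0 : phi 0 w = 0.
    by have := phil w (-1) 0 0; rewrite /= scaleN1r oppr0 addr0 scaleN1r addNr.
  by move: (phil w c v 0); rewrite addr0 h0 addr0.
- move=> c v w; have h0 : phi v 0 = 0.
    by have := phir v (-1) 0 0; rewrite /= scaleN1r oppr0 addr0 scaleN1r addNr.
  by move: (phir v c w 0); rewrite addr0 h0 addr0.
Qed.

Lemma tlift_class s : tlift (tclass s) = teval s.
Proof. exact/teval_eq/repr_tclass. Qed.

Lemma tliftE v w : tlift (tpure v w) = phi v w.
Proof. exact: tlift_class. Qed.

Lemma tlift_is_linear : linear tlift.
Proof.
move=> c; do 2![elim/tind=> ?].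
by rewrite -tclassZ -tclassD !tlift_class.
Qed.
End Lift.
End Tensor.

Section TensorMap.
Variables (K : fieldType) (V V' W W' : lmodType K).
Variables (f : {linear V -> V'}) (g : {linear W -> W'}).

Definition tmap : tensor V W -> tensor V' W' :=
  tlift (fun v w => tpure (f v) (g w)).

Let bil (w : W) : linear (fun v => tpure (f v) (g w)).
Proof. by move=> c v v'; rewrite linearP tpureDl tpureZl. Qed.
Let bir (v : V) : linear (fun w => tpure (f v) (g w)).
Proof. by move=> c w w'; rewrite linearP tpureDr tpureZr. Qed.

Lemma tmapE v w : tmap (tpure v w) = tpure (f v) (g w).
Proof. exact: tliftE. Qed.

Lemma tmap_is_linear : linear tmap.
Proof. exact: tlift_is_linear. Qed.

HB.instance Definition _ :=
  GRing.isLinear.Build K (tensor V W) (tensor V' W') _ tmap tmap_is_linear.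
End TensorMap.

(** * Algebras presented by generators and relations *)

Inductive aexpr (K : fieldType) (G : Type) :=
| AGen of G | AZero | AOne | AOpp of aexpr K G | AAdd of aexpr K G & aexpr K G
| AScale of K & aexpr K G | AMul of aexpr K G & aexpr K G.

Arguments AGen {K G}.
Arguments AZero {K G}.
Arguments AOne {K G}.

Section Presented.
Variables (K : fieldType) (G : Type).
Local Notation E := (aexpr K G).
Variable rel : E -> E -> Prop.

(* The congruence generated by rel and the axioms of associative unital
   K-algebras. *)
Inductive aeq : E -> E -> Prop :=
| aeq_rel s t : rel s t -> aeq s t
| aeq_refl s : aeq s s
| aeq_sym s t : aeq s t -> aeq t s
| aeq_trans s t u : aeq s t -> aeq t u -> aeq s u
| aeq_opp s s' : aeq s s' -> aeq (AOpp s) (AOpp s')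
| aeq_add s s' t t' : aeq s s' -> aeq t t' -> aeq (AAdd s t) (AAdd s' t')
| aeq_scale c s s' : aeq s s' -> aeq (AScale c s) (AScale c s')
| aeq_mul s s' t t' : aeq s s' -> aeq t t' -> aeq (AMul s t) (AMul s' t')
| aeq_addA s t u : aeq (AAdd s (AAdd t u)) (AAdd (AAdd s t) u)
| aeq_addC s t : aeq (AAdd s t) (AAdd t s)
| aeq_add0 s : aeq (AAdd AZero s) s
| aeq_addN s : aeq (AAdd (AOpp s) s) AZero
| aeq_scaleA c d s : aeq (AScale c (AScale d s)) (AScale (c * d) s)
| aeq_scale1 s : aeq (AScale 1 s) s
| aeq_scaleDr c s t : aeq (AScale c (AAdd s t)) (AAdd (AScale c s) (AScale c t))
| aeq_scaleDl c d s : aeq (AScale (c + d) s) (AAdd (AScale c s) (AScale d s))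
| aeq_mulA s t u : aeq (AMul s (AMul t u)) (AMul (AMul s t) u)
| aeq_mul1l s : aeq (AMul AOne s) s
| aeq_mul1r s : aeq (AMul s AOne) s
| aeq_mulDl s t u : aeq (AMul (AAdd s t) u) (AAdd (AMul s u) (AMul t u))
| aeq_mulDr s t u : aeq (AMul s (AAdd t u)) (AAdd (AMul s t) (AMul s u))
| aeq_scaleAl c s t : aeq (AScale c (AMul s t)) (AMul (AScale c s) t)
| aeq_scaleAr c s t : aeq (AScale c (AMul s t)) (AMul s (AScale c t)).

HB.instance Definition _ := gen_eqMixin E.
HB.instance Definition _ := gen_choiceMixin E.

Definition aeqb s t : bool := `[< aeq s t >].

Lemma aeqb_equiv : equiv_class_of aeqb.
Proof.
split=> [s|s t|t s u]; first by apply/asboolP; apply: aeq_refl.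
  by apply/asboolP/asboolP; apply: aeq_sym.
by move=> /asboolP st /asboolP tu; apply/asboolP; apply: aeq_trans tu.
Qed.

Canonical aeqb_equivRel := EquivRelPack aeqb_equiv.

Definition presented := {eq_quot aeqb}.
HB.instance Definition _ := Choice.on presented.
HB.instance Definition _ : EqQuotient E aeqb presented := EqQuotient.on presented.

Definition aclass (s : E) : presented := \pi_presented s.

Lemma aclass_eq s t : aeq s t <-> aclass s = aclass t.
Proof.
split=> [h|/eqP]; first by apply/eqmodP/asboolP.
by rewrite eqmodE => /asboolP.
Qed.

Lemma aclassK x : aclass (repr x) = x.
Proof. exact: reprK. Qed.

Lemma repr_aclass s : aeq (repr (aclass s)) s.
Proof. by apply/aclass_eq; rewrite aclassK. Qed.

Definition a_add (x y : presented) := aclass (AAdd (repr x) (repr y)).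
Definition a_opp (x : presented) := aclass (AOpp (repr x)).
Definition a_scale c (x : presented) := aclass (AScale c (repr x)).
Definition a_mul (x y : presented) := aclass (AMul (repr x) (repr y)).

Lemma aaddE s t : a_add (aclass s) (aclass t) = aclass (AAdd s t).
Proof. by apply/aclass_eq/aeq_add; exact: repr_aclass. Qed.
Lemma aoppE s : a_opp (aclass s) = aclass (AOpp s).
Proof. by apply/aclass_eq/aeq_opp/repr_aclass. Qed.
Lemma ascaleE c s : a_scale c (aclass s) = aclass (AScale c s).
Proof. by apply/aclass_eq/aeq_scale/repr_aclass. Qed.
Lemma amulE s t : a_mul (aclass s) (aclass t) = aclass (AMul s t).
Proof. by apply/aclass_eq/aeq_mul; exact: repr_aclass. Qed.

Lemma aind (P : presented -> Prop) : (forall s, P (aclass s)) -> forall x, P x.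
Proof. by move=> h x; rewrite -[x]aclassK. Qed.

Fact a_addA : associative a_add.
Proof. do 3![elim/aind=> ?]; rewrite !aaddE; exact/aclass_eq/aeq_addA. Qed.
Fact a_addC : commutative a_add.
Proof. do 2![elim/aind=> ?]; rewrite !aaddE; exact/aclass_eq/aeq_addC. Qed.
Fact a_add0 : left_id (aclass AZero) a_add.
Proof. elim/aind=> ?; rewrite !aaddE; exact/aclass_eq/aeq_add0. Qed.
Fact a_addN : left_inverse (aclass AZero) a_opp a_add.
Proof. elim/aind=> ?; rewrite !aoppE !aaddE; exact/aclass_eq/aeq_addN. Qed.

HB.instance Definition _ := GRing.isZmodule.Build presented a_addA a_addC a_add0 a_addN.

Lemma aclassD s t : aclass (AAdd s t) = aclass s + aclass t.
Proof. exact/esym/aaddE. Qed.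
Lemma aclassN s : aclass (AOpp s) = - aclass s.
Proof. exact/esym/aoppE. Qed.
Lemma aclass0 : aclass AZero = 0.
Proof. by []. Qed.

Fact a_mulA : associative a_mul.
Proof. do 3![elim/aind=> ?]; rewrite !amulE; exact/aclass_eq/aeq_mulA. Qed.
Fact a_mul1l : left_id (aclass AOne) a_mul.
Proof. elim/aind=> ?; rewrite !amulE; exact/aclass_eq/aeq_mul1l. Qed.
Fact a_mul1r : right_id (aclass AOne) a_mul.
Proof. elim/aind=> ?; rewrite !amulE; exact/aclass_eq/aeq_mul1r. Qed.
Fact a_mulDl : left_distributive a_mul +%R.
Proof.
do 3![elim/aind=> ?]; rewrite -aclassD !amulE -aclassD.
exact/aclass_eq/aeq_mulDl.
Qed.
Fact a_mulDr : right_distributive a_mul +%R.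
Proof.
do 3![elim/aind=> ?]; rewrite -aclassD !amulE -aclassD.
exact/aclass_eq/aeq_mulDr.
Qed.

HB.instance Definition _ := GRing.Zmodule_isPzRing.Build presented
  a_mulA a_mul1l a_mul1r a_mulDl a_mulDr.

Fact a_scaleA c d x : a_scale c (a_scale d x) = a_scale (c * d) x.
Proof. elim/aind: x => s; rewrite !ascaleE; exact/aclass_eq/aeq_scaleA. Qed.
Fact a_scale1 : left_id 1 a_scale.
Proof. elim/aind=> s; rewrite !ascaleE; exact/aclass_eq/aeq_scale1. Qed.
Fact a_scaleDr : right_distributive a_scale +%R.
Proof.
move=> c; do 2![elim/aind=> ?]; rewrite -aclassD !ascaleE -aclassD.
exact/aclass_eq/aeq_scaleDr.
Qed.
Fact a_scaleDl x : {morph a_scale^~ x : c d / c + d}.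
Proof.
move=> c d; elim/aind: x => s; rewrite !ascaleE -aclassD.
exact/aclass_eq/aeq_scaleDl.
Qed.

HB.instance Definition _ := GRing.Zmodule_isLmodule.Build K presented
  a_scaleA a_scale1 a_scaleDr a_scaleDl.

Lemma aclass1 : aclass AOne = 1.
Proof. by []. Qed.
Lemma aclassM s t : aclass (AMul s t) = aclass s * aclass t.
Proof. exact/esym/amulE. Qed.
Lemma aclassZ c s : aclass (AScale c s) = c *: aclass s.
Proof. exact/esym/ascaleE. Qed.

Lemma presented_scaleAl c (x y : presented) : c *: (x * y) = c *: x * y.
Proof.
elim/aind: x => s; elim/aind: y => t.
by rewrite -aclassM -!aclassZ -aclassM; apply/aclass_eq/aeq_scaleAl.
Qed.
Lemma presented_scaleAr c (x y : presented) : c *: (x * y) = x * (c *: y).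
Proof.
elim/aind: x => s; elim/aind: y => t.
by rewrite -aclassM -!aclassZ -aclassM; apply/aclass_eq/aeq_scaleAr.
Qed.

(* Universal property; alift is meaningful when phi satisfies the relations. *)
Section Lift.
Variables (A : algType K) (phi : G -> A).

Fixpoint aeval s : A :=
  match s with
  | AGen g => phi g
  | AZero => 0
  | AOne => 1
  | AOpp s => - aeval s
  | AAdd s t => aeval s + aeval t
  | AScale c s => c *: aeval s
  | AMul s t => aeval s * aeval t
  end.

Definition alift (x : presented) : A := aeval (repr x).

Hypothesis phi_rel : forall s t, rel s t -> aeval s = aeval t.

Lemma aeval_eq s t : aeq s t -> aeval s = aeval t.
Proof.
elim=> //=; try by move=> *; congruence.
- by move=> *; rewrite addrA.
- by move=> *; rewrite addrC.
- by move=> *; rewrite add0r.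
- by move=> *; rewrite addNr.
- by move=> *; rewrite scalerA.
- by move=> *; rewrite scale1r.
- by move=> *; rewrite scalerDr.
- by move=> *; rewrite scalerDl.
- by move=> *; rewrite mulrA.
- by move=> *; rewrite mul1r.
- by move=> *; rewrite mulr1.
- by move=> *; rewrite mulrDl.
- by move=> *; rewrite mulrDr.
- by move=> *; rewrite scalerAl.
- by move=> *; rewrite scalerAr.
Qed.

Lemma alift_class s : alift (aclass s) = aeval s.
Proof. exact/aeval_eq/repr_aclass. Qed.

Lemma alift1 : alift 1 = 1.
Proof. by rewrite -aclass1 alift_class. Qed.

Lemma alift_is_linear : linear alift.
Proof.
move=> c; do 2![elim/aind=> ?].
by rewrite -aclassZ -aclassD !alift_class.
Qed.

Lemma aliftM : {morph alift : x y / x * y}.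
Proof. by do 2![elim/aind=> ?]; rewrite -aclassM !alift_class. Qed.
End Lift.
End Presented.

(** * Cartan data, roots *)

(* The Cartan matrix of a complex simple Lie algebra of rank l, together with
   the normalised invariant form. *)
Record simple_datum (l : nat) := SimpleDatum {
  cartan :> 'M[int]_l;      (* a_ij = (alpha_i^vee, alpha_j) *)
  half_sq : 'I_l -> nat;    (* (alpha_i, alpha_i) / 2 *)
  cartan_diag : forall i, cartan i i = 2;
  cartan_offdiag : forall i j, i != j -> cartan i j <= 0;
  half_sq_gt0 : forall i, (0 < half_sq i)%N;
  half_sq_min : exists i, half_sq i = 1%N;
  cartan_sym : forall i j,
    (half_sq i)%:Z * cartan i j = (half_sq j)%:Z * cartan j i;
  (* positivity on the root lattice, which amounts to positivity on its real
     span since the form is rational *)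
  cartan_posdef : forall u : 'rV[int]_l, u != 0 ->
    0 < \sum_i \sum_j u 0 i * ((half_sq i)%:Z * cartan i j) * u 0 j;
  cartan_indecomposable : forall S : {set 'I_l},
    (exists i, i \in S) -> (exists j, j \notin S) ->
    exists i j, [/\ i \in S, j \notin S & cartan i j != 0]
}.

Section Roots.
Variables (l : nat) (D : simple_datum l).

(* Elements of the root lattice are given by their coordinates in the basis of
   simple roots. *)
Definition simple_root (i : 'I_l) : 'rV[int]_l := delta_mx 0 i.

Definition coroot_pairing (i : 'I_l) (b : 'rV[int]_l) : int :=
  \sum_j D i j * b 0 j.

Definition simple_refl (i : 'I_l) (b : 'rV[int]_l) : 'rV[int]_l :=
  b - coroot_pairing i b *: simple_root i.

(* R = W Pi *)
Inductive is_root : 'rV[int]_l -> Prop :=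
| root_simple i : is_root (simple_root i)
| root_refl i b : is_root b -> is_root (simple_refl i b).

Definition highest_root (t : 'rV[int]_l) : Prop :=
  is_root t /\ forall b, is_root b -> forall i, b 0 i <= t 0 i.
(* alpha_x has coefficient 1 in the highest root. *)
Definition irreducible_node (x : 'I_l) : Prop :=
  exists2 t, highest_root t & t 0 x = 1.
End Roots.

(** * The quantised enveloping algebra *)

Section QuantumNumbers.
Variable K : fieldType.
Implicit Type p : K.

Definition qint p (n : nat) : K := (p ^+ n - p ^- n) / (p - p^-1).
Definition qfact p (n : nat) : K := \prod_(1 <= m < n.+1) qint p m.
Definition qbinom p (n k : nat) : K := qfact p n / (qfact p k * qfact p (n - k)).
End QuantumNumbers.

Inductive Uq_gen (l : nat) :=
| GE of 'I_l | GF of 'I_l | GK of 'I_l | GKinv of 'I_l.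

Section Uq.
Variables (R : realType) (l : nat) (D : simple_datum l) (q : R).
Local Notation C := (R[i]).
Local Notation expr := (aexpr C (Uq_gen l)).

Definition qC : C := q%:C%C.
Definition qi (i : 'I_l) : C := qC ^+ half_sq D i.

Let eE i : expr := AGen (GE i).
Let eF i : expr := AGen (GF i).
Let eK i : expr := AGen (GK i).
Let eKV i : expr := AGen (GKinv i).
Let eX (s : expr) (n : nat) : expr := iter n (AMul s) AOne.
Let eB (s t : expr) : expr := AAdd s (AOpp t).

(* \sum_(k <= n) (-1)^k [n choose k]_(q_i) x^(n-k) y x^k, n = 1 - a_ij *)
Let eSerre i j (x y : expr) : expr :=
  let n := `|1 - D i j|%N in
  \big[@AAdd _ _/AZero]_(k < n.+1)
    AScale ((-1) ^+ k * qbinom (qi i) n k) (AMul (eX x (n - k)) (AMul y (eX x k))).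

Inductive Uq_rel : expr -> expr -> Prop :=
| Uq_KKV i : Uq_rel (AMul (eK i) (eKV i)) AOne
| Uq_KVK i : Uq_rel (AMul (eKV i) (eK i)) AOne
| Uq_KK i j : Uq_rel (AMul (eK i) (eK j)) (AMul (eK j) (eK i))
| Uq_KE i j : Uq_rel (AMul (eK i) (eE j))
                     (AScale (qi i ^ D i j) (AMul (eE j) (eK i)))
| Uq_KF i j : Uq_rel (AMul (eK i) (eF j))
                     (AScale (qi i ^ (- D i j)) (AMul (eF j) (eK i)))
| Uq_EF i j : Uq_rel (eB (AMul (eE i) (eF j)) (AMul (eF j) (eE i)))
                     (AScale ((i == j)%:R / (qi i - (qi i)^-1)) (eB (eK i) (eKV i)))
| Uq_serreE i j : i != j -> Uq_rel (eSerre i j (eE i) (eE j)) AZero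
| Uq_serreF i j : i != j -> Uq_rel (eSerre i j (eF i) (eF j)) AZero.

Definition Uq := presented Uq_rel.
HB.instance Definition _ := GRing.PzRing.on Uq.
HB.instance Definition _ := GRing.Lmodule.on Uq.

Definition counit_gen (g : Uq_gen l) : C^o :=
  match g with GE _ | GF _ => 0 | GK _ | GKinv _ => 1 end.

Lemma counit_rel s t : Uq_rel s t -> aeval counit_gen s = aeval counit_gen t.
Proof.
have serre i j x y : i != j -> aeval counit_gen x = 0 -> aeval counit_gen y = 0 ->
    aeval counit_gen (eSerre i j x y) = 0.
  move=> ij x0 y0; rewrite /eSerre; elim/big_ind: _ => //= [s' t' -> ->|k _].
    by rewrite addr0.
  by rewrite y0 mul0r mulr0 scaler0.
case=> //= *; rewrite ?mulr1 ?mulr0 ?mul0r ?subrr ?scaler0 //.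
- exact: serre.
- exact: serre.
Qed.

Definition counit : Uq -> C^o := alift counit_gen.

Lemma Uq_nontrivial : (1 : Uq) != 0.
Proof.
apply/eqP => h; have := alift1 counit_rel; rewrite h.
have -> : alift counit_gen (0 : presented Uq_rel) = 0.
  by rewrite -aclass0 (alift_class counit_rel).
by move/esym/eqP; rewrite oner_eq0.
Qed.

HB.instance Definition _ := GRing.PzSemiRing_isNonZero.Build Uq Uq_nontrivial.
HB.instance Definition _ := GRing.Lmodule_isLalgebra.Build C Uq
  (@presented_scaleAl _ _ Uq_rel).
HB.instance Definition _ := GRing.Lalgebra_isAlgebra.Build C Uq
  (@presented_scaleAr _ _ Uq_rel).

HB.instance Definition _ :=
  GRing.isLinear.Build C Uq C^o _ counit (alift_is_linear counit_rel).
HB.instance Definition _ := GRing.isMonoidMorphism.Build Uq C^o counit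
  (conj (alift1 counit_rel) (aliftM counit_rel)).

Definition uE i : Uq := aclass _ (eE i).
Definition uF i : Uq := aclass _ (eF i).
Definition uK i : Uq := aclass _ (eK i).
Definition uKV i : Uq := aclass _ (eKV i).

Lemma counitE i : counit (uE i) = 0.
Proof. exact: alift_class counit_rel _. Qed.
Lemma counitF i : counit (uF i) = 0.
Proof. exact: alift_class counit_rel _. Qed.
Lemma counitK i : counit (uK i) = 1.
Proof. exact: alift_class counit_rel _. Qed.
Lemma counitKV i : counit (uKV i) = 1.
Proof. exact: alift_class counit_rel _. Qed.

Let ueq s t (h : Uq_rel s t) : aclass Uq_rel s = aclass Uq_rel t.
Proof. exact/aclass_eq/aeq_rel. Qed.

Lemma uKKV i : uK i * uKV i = 1.
Proof. by have := ueq (Uq_KKV i); rewrite aclassM. Qed.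
Lemma uKVK i : uKV i * uK i = 1.
Proof. by have := ueq (Uq_KVK i); rewrite aclassM. Qed.
Lemma uKC i j : uK i * uK j = uK j * uK i.
Proof. by have := ueq (Uq_KK i j); rewrite !aclassM. Qed.
Lemma uKE i j : uK i * uE j = qi i ^ D i j *: (uE j * uK i).
Proof. by have := ueq (Uq_KE i j); rewrite aclassZ !aclassM. Qed.
Lemma uKF i j : uK i * uF j = qi i ^ (- D i j) *: (uF j * uK i).
Proof. by have := ueq (Uq_KF i j); rewrite aclassZ !aclassM. Qed.
Lemma uEF i j : uE i * uF j - uF j * uE i =
  ((i == j)%:R / (qi i - (qi i)^-1)) *: (uK i - uKV i).
Proof.
by have := ueq (Uq_EF i j); rewrite aclassZ !aclassD !aclassN !aclassM.
Qed.

Let aclassX s n : aclass Uq_rel (eX s n) = aclass Uq_rel s ^+ n.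
Proof. by elim: n => [|n IH]; rewrite ?expr0 //= aclassM IH exprS. Qed.

Let serre_class i j s t : aclass Uq_rel (eSerre i j s t) =
  \sum_(k < `|1 - D i j|.+1) ((-1) ^+ k * qbinom (qi i) `|1 - D i j| k) *:
    (aclass Uq_rel s ^+ (`|1 - D i j| - k) * (aclass Uq_rel t * aclass Uq_rel s ^+ k)).
Proof.
rewrite /eSerre (big_morph _ (@aclassD _ _ Uq_rel) (aclass0 Uq_rel)).
by apply: eq_bigr => k _; rewrite aclassZ !aclassM !aclassX.
Qed.

Lemma userreE i j : i != j ->
  \sum_(k < `|1 - D i j|.+1) ((-1) ^+ k * qbinom (qi i) `|1 - D i j| k) *:
    (uE i ^+ (`|1 - D i j| - k) * (uE j * uE i ^+ k)) = 0.
Proof. by move=> ij; have := ueq (Uq_serreE ij); rewrite serre_class. Qed.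

Lemma userreF i j : i != j ->
  \sum_(k < `|1 - D i j|.+1) ((-1) ^+ k * qbinom (qi i) `|1 - D i j| k) *:
    (uF i ^+ (`|1 - D i j| - k) * (uF j * uF i ^+ k)) = 0.
Proof. by move=> ij; have := ueq (Uq_serreF ij); rewrite serre_class. Qed.
End Uq.

(** * The quantised coordinate algebra *)

Section Coordinate.
Variables (R : realType) (l : nat) (D : simple_datum l) (q : R).
Local Notation C := (R[i]).
Local Notation U := (Uq D q).
Local Notation dual := (U -> C^o).

(* A finite-dimensional left U-module is given by matrices acting on column
   vectors, a functional on it by a row vector. *)
Definition irreducible_module n (rho : U -> 'M[C]_n.+1) : Prop :=
  forall W : subspace 'cV[C]_n.+1,
    (forall X w, W w -> W (rho X *m w)) ->
    (forall w, W w -> w = 0) \/ (forall w, W w).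

(* rho is a model of V_lambda, lambda in P^+ being given by its labels
   lam i = (alpha_i^vee, lambda), so that (alpha_i, lambda) = half_sq i * lam i.
   By irreducibility v generates the module. *)
Definition is_V (lam : 'I_l -> nat) n (rho : {lrmorphism U -> 'M[C]_n.+1}) : Prop :=
  irreducible_module rho /\
  exists v : 'cV[C]_n.+1, [/\ v != 0,
    forall i, rho (uE D q i) *m v = 0 &
    forall i, rho (uK D q i) *m v = qC q ^+ (half_sq D i * lam i) *: v].

Definition coef n (rho : U -> 'M[C]_n.+1) (f : 'rV[C]_n.+1) (v : 'cV[C]_n.+1) : dual :=
  fun X => (f *m (rho X *m v)) 0 0.

Definition is_coef (a : dual) : Prop :=
  exists (lam : 'I_l -> nat) n (rho : {lrmorphism U -> 'M[C]_n.+1}) f v,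
    is_V lam rho /\ a = coef rho f v.

(* O_q(G) as a subspace of the dual of U_q(g) *)
Definition Oq : subspace dual := lspan is_coef.

Lemma Oq_ind (P : dual -> Prop) :
  (forall lam n (rho : {lrmorphism U -> 'M[C]_n.+1}) f v,
     is_V lam rho -> P (coef rho f v)) ->
  P 0 -> (forall c a b, P a -> P b -> P (c *: a + b)) -> forall a, Oq a -> P a.
Proof.
move=> Pc P0 PD a; elim=> // c x y [lam [n [rho [f [v [h ->]]]]]] _ Py.
by apply: PD => //; apply: Pc h.
Qed.


Lemma dualE c (a b : dual) X : (c *: a + b) X = c * a X + b X :> C.
Proof. by []. Qed.

Lemma Oq_linear a : Oq a -> linear a.
Proof.
elim/Oq_ind => [lam n rho f v _ c X Y|c X Y|c b b' hb hb' d X Y].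
- by rewrite /coef linearP mulmxDl mulmxDr -!scalemxAl -scalemxAr !mxE.
- by rewrite /= scaler0 addr0.
rewrite !dualE hb hb'; rewrite /GRing.scale /=.
by rewrite !mulrDr !mulrA [c * d]mulrC; exact: addrACA.
Qed.

End Coordinate.

Section TensorForm.
Variables (K : fieldType) (V W : lmodType K).

Lemma tpure_suml (I : Type) (r : seq I) (P : pred I) (F : I -> V) (w : W) :
  tpure (\sum_(i <- r | P i) F i) w = \sum_(i <- r | P i) tpure (F i) w.
Proof.
apply: (big_morph (fun v => tpure v w)) => [v v'|]; first exact: tpureDl.
by rewrite -[0 in LHS](scale0r 0) tpureZl scale0r.
Qed.

Definition lin_indep n (a : 'I_n -> V) : Prop :=
  forall g : 'I_n -> K, \sum_i g i *: a i = 0 -> forall i, g i = 0.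

Lemma tensor_sum (t : tensor V W) :
  exists n (a : 'I_n -> V) (b : 'I_n -> W), t = \sum_i tpure (a i) (b i).
Proof.
elim/tensor_ind: t => [|c v w t [n [a [b ->]]]].
  by exists 0%N, (fun=> 0), (fun=> 0); rewrite big_ord0.
exists n.+1, (fun i => oapp a (c *: v) (unlift ord0 i)),
  (fun i => oapp b w (unlift ord0 i)).
rewrite big_ord_recl unlift_none /= tpureZl; congr (_ + _).
by apply: eq_bigr => i _; rewrite liftK.
Qed.

Lemma tensor_indep (t : tensor V W) :
  exists n (a : 'I_n -> V) (b : 'I_n -> W),
    lin_indep a /\ t = \sum_i tpure (a i) (b i).
Proof.
have [n [a [b ->]]] := tensor_sum t.
elim: n a b => [|n IH] a b.
  by exists 0%N, a, b; split=> // g _ [].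
have [ia|] := pselect (lin_indep a); first by exists n.+1, a, b.
move/existsNP => [g /not_implyP[g0 /existsNP[i /eqP gi]]].
have ai : a i = \sum_(k < n) - (g (lift i k) / g i) *: a (lift i k).
  apply: (scalerI gi); move: g0; rewrite (bigD1_ord i) //= => /eqP.
  rewrite addr_eq0 => /eqP ->; rewrite scaler_sumr -sumrN.
  by apply: eq_bigr => k _; rewrite scalerA mulrN mulrCA divff // mulr1 scaleNr.
have -> : \sum_k tpure (a k) (b k) =
    \sum_(k < n) tpure (a (lift i k)) (b (lift i k) - (g (lift i k) / g i) *: b i).
  rewrite (bigD1_ord i) //= ai tpure_suml -big_split /=.
  apply: eq_bigr => k _.
  by rewrite tpureZl tpureDr -scaleNr tpureZr addrC.
exact: IH.
Qed.
End TensorForm.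

(* The multiplication of O_q(G) (hence the coproduct of U_q(g)) and the
   B-bimodule structure of Omega^(0,1) are not set up: the linear map dbar only
   involves the coalgebra O_q(G), its two U_q(g)-actions and the unit. *)
Section Flag.
Variables (R : realType) (l : nat) (D : simple_datum l) (q : R).
Local Notation C := (R[i]).
Local Notation U := (Uq D q).
Local Notation dual := (U -> C^o).
Local Notation O := (Oq D q).

(* (X |> a)(Y) = a_(1)(Y) a_(2)(X) = a(YX), (a <| X)(Y) = a_(1)(X) a_(2)(Y) = a(XY) *)
Definition lact_dual (X : U) (a : dual) : dual := fun Y => a (Y * X).
Definition ract_dual (X : U) (a : dual) : dual := fun Y => a (X * Y).

Lemma Oq_lact X a : O a -> O (lact_dual X a).
Proof.
elim/Oq_ind => [lam n rho f v h||c b b' hb hb'].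
- apply: lspan_gen; exists lam, n, rho, f, (rho X *m v); split=> //.
  by apply/funext => Y; rewrite /lact_dual /coef rmorphM -mulmxA.
- exact: smem0.
- exact: smemP.
Qed.

Lemma Oq_ract X a : O a -> O (ract_dual X a).
Proof.
elim/Oq_ind => [lam n rho f v h||c b b' hb hb'].
- apply: lspan_gen; exists lam, n, rho, (f *m rho X), v; split=> //.
  by apply/funext => Y; rewrite /ract_dual /coef rmorphM -!mulmxA.
- exact: smem0.
- exact: smemP.
Qed.

Definition lact (X : U) (a : O) : O := mksub (Oq_lact X (subvalP a)).
Definition ract (X : U) (a : O) : O := mksub (Oq_ract X (subvalP a)).

Lemma lactE X (a : O) Y : subval (lact X a) Y = subval a (Y * X).
Proof. by []. Qed.
Lemma ractE X (a : O) Y : subval (ract X a) Y = subval a (X * Y).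
Proof. by []. Qed.

Lemma OqP (a b : O) : (forall X, subval a X = subval b X) -> a = b.
Proof. by move=> h; apply/subval_inj/funext. Qed.

Lemma subvalDE (c : C) (a b : O) X :
  subval (c *: a + b) X = c * subval a X + subval b X :> C.
Proof. by rewrite linearP. Qed.

Lemma subval0E X : subval (0 : O) X = 0 :> C.
Proof. by rewrite linear0. Qed.

Lemma subval_sumE n (a : 'I_n -> O) X :
  subval (\sum_i a i) X = \sum_i subval (a i) X :> C.
Proof. by rewrite linear_sum fct_sumE. Qed.

Lemma subvalZE (c : C) (a : O) X : subval (c *: a) X = c * subval a X :> C.
Proof. by rewrite linearZ. Qed.

Lemma lact_is_linear X : linear (lact X).
Proof. by move=> c a b; apply: OqP => Y; rewrite lactE !subvalDE. Qed.
Lemma ract_is_linear X : linear (ract X).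
Proof. by move=> c a b; apply: OqP => Y; rewrite ractE !subvalDE. Qed.
HB.instance Definition _ X := GRing.isLinear.Build C O O _ (lact X) (lact_is_linear X).
HB.instance Definition _ X := GRing.isLinear.Build C O O _ (ract X) (ract_is_linear X).

(* The counit of O_q(G) is evaluation at 1, its unit is the counit of U_q(g). *)
Definition counitO (a : O) : C := subval a 1.

Section Trivial.
Definition triv_rep (X : U) : 'M[C]_1 := (counit X)%:M.

Lemma triv_rep_is_linear : linear triv_rep.
Proof. by move=> c X Y; rewrite /triv_rep linearP raddfD /= -scale_scalar_mx. Qed.
Lemma triv_rep_is_monoid : monoid_morphism triv_rep.
Proof. by split=> [|X Y]; rewrite /triv_rep ?rmorph1 // rmorphM scalar_mxM. Qed.
HB.instance Definition _ := GRing.isLinear.Build C U 'M[C]_1 _ triv_rep triv_rep_is_linear.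
HB.instance Definition _ := GRing.isMonoidMorphism.Build U 'M[C]_1 triv_rep triv_rep_is_monoid.

Lemma Oq_counit : O (@counit R l D q).
Proof.
apply: lspan_gen; exists (fun=> 0%N), 0%N, triv_rep, 1%:M, 1%:M; split; last first.
  by apply/funext => X; rewrite /coef mulmx1 mul1mx mxE eqxx mulr1n.
split=> [W _|]; last first.
  exists 1%:M; split=> [|i|i].
  - by apply/eqP => /matrixP/(_ 0 0); rewrite !mxE => /eqP; rewrite oner_eq0.
  - by rewrite /= /triv_rep counitE mulmx1; apply/matrixP => ? ?; rewrite !mxE mul0rn.
  - by rewrite /= /triv_rep counitK mulmx1 muln0 expr0 scale1r.
have [h|/existsNP[w /not_implyP[Ww w0]]] := pselect (forall w, W w -> w = 0).
  by left.
right=> w'; have w00 : w 0 0 != 0.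
  by apply/eqP => h; apply: w0; apply/matrixP => i j; rewrite !ord1 h mxE.
have -> : w' = (w' 0 0 / w 0 0) *: w.
  by apply/matrixP => i j; rewrite !ord1 mxE mulfVK.
exact: smemZ.
Qed.
End Trivial.

Definition oneO : O := mksub Oq_counit.

(** * Quantum flag manifolds *)

Section FlagS.
Variable S : {set 'I_l}.

Inductive Ul : U -> Prop :=
| Ul_K i : Ul (uK D q i)
| Ul_KV i : Ul (uKV D q i)
| Ul_E i : i \in S -> Ul (uE D q i)
| Ul_F i : i \in S -> Ul (uF D q i)
| Ul_1 : Ul 1
| Ul_lin c X Y : Ul X -> Ul Y -> Ul (c *: X + Y)
| Ul_mul X Y : Ul X -> Ul Y -> Ul (X * Y).

Definition is_Ul_invariant (b : O) : Prop :=
  forall X, Ul X -> lact X b = counit X *: b.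

Lemma Ul_invariant0 : is_Ul_invariant 0.
Proof. by move=> X _; rewrite linear0 scaler0. Qed.

Lemma Ul_invariantP c a b :
  is_Ul_invariant a -> is_Ul_invariant b -> is_Ul_invariant (c *: a + b).
Proof.
move=> ha hb X UX; rewrite lact_is_linear ha // hb // scalerDr !scalerA.
by rewrite [c * _]mulrC.
Qed.

(* O_q(G/L_S) *)
Definition OqGL : subspace O := Subspace Ul_invariant0 Ul_invariantP.

Definition ev (b : OqGL) : U -> C := subval (subval b).

Lemma evP (a b : OqGL) : (forall X, ev a X = ev b X) -> a = b.
Proof. by move=> h; apply/subval_inj/OqP. Qed.

Lemma evDE (c : C) (a b : OqGL) X : ev (c *: a + b) X = c * ev a X + ev b X.
Proof. by rewrite /ev !subval_is_linear. Qed.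

Lemma ev0 X : ev (0 : OqGL) X = 0.
Proof. by have := evDE (-1) 0 0 X; rewrite scaleN1r oppr0 addr0 mulN1r addNr. Qed.

Lemma ev_Ul (b : OqGL) X Y : Ul Y -> ev b (X * Y) = counit Y * ev b X :> C.
Proof.
move=> UY; have /(congr1 (fun a => subval a X)) := subvalP b Y UY.
by rewrite lactE linearZ.
Qed.

Lemma oneO_invariant : OqGL oneO.
Proof.
move=> X _; apply: OqP => Y; rewrite lactE linearZ /=.
by rewrite rmorphM mulrC.
Qed.

Definition oneB : OqGL := mksub oneO_invariant.

Lemma ract_invariant X (b : O) : OqGL b -> OqGL (ract X b).
Proof.
move=> hb Y UY; apply: OqP => Z.
rewrite lactE ractE linearZ /= mulrA.
have /(congr1 (fun a => subval a (X * Z))) := hb Y UY.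
by rewrite lactE linearZ.
Qed.

Definition ractB X (b : OqGL) : OqGL := mksub (ract_invariant X (subvalP b)).

Lemma ev_ractB X b Y : ev (ractB X b) Y = ev b (X * Y).
Proof. by []. Qed.

(* The coproduct restricts to O_q(G/L_S) -> O_q(G) (x) O_q(G/L_S); it is
   determined by b_(1)(X) b_(2)(Y) = b(XY). *)
Definition tpair (W : lmodType C) (e : W -> dual) (t : tensor O W) (X Y : U) : C :=
  tlift (fun (a : O) w => subval a X * e w Y : C^o) t.

Section Tpair.
Variables (W : lmodType C) (e : W -> dual).
Hypothesis e_lin : linear e.

Let bil X Y (w : W) : linear (fun a : O => subval a X * e w Y : C^o).
Proof. by move=> c a b; rewrite subvalDE mulrDl -mulrA. Qed.
Let bir X Y (a : O) : linear (fun w => subval a X * e w Y : C^o).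
Proof. by move=> c w w'; rewrite e_lin dualE mulrDr mulrCA. Qed.

Lemma tpairE a w X Y : tpair e (tpure a w) X Y = subval a X * e w Y.
Proof. exact: tliftE (bil X Y) (bir X Y) _ _. Qed.

Lemma tpairD c s t X Y :
  tpair e (c *: s + t) X Y = c * tpair e s X Y + tpair e t X Y.
Proof. exact: tlift_is_linear (bil X Y) (bir X Y) c s t. Qed.

Lemma tpair0 X Y : tpair e 0 X Y = 0.
Proof. by rewrite -(tpure0r W (0 : O)) tpairE linear0 mul0r. Qed.

Lemma tpair_sum n (t : 'I_n -> tensor O W) X Y :
  tpair e (\sum_i t i) X Y = \sum_i tpair e (t i) X Y.
Proof.
apply: (big_morph (fun t => tpair e t X Y)) => [s s'|]; last exact: tpair0.
by have := tpairD 1 s s' X Y; rewrite scale1r mul1r.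
Qed.

Lemma tpair_inj : injective e ->
  forall s t, (forall X Y, tpair e s X Y = tpair e t X Y) -> s = t.
Proof.
move=> e_inj s t st; apply/eqP; rewrite -subr_eq0; apply/eqP.
have : forall X Y, tpair e (s - t) X Y = 0.
  by move=> X Y; rewrite addrC -scaleN1r tpairD st mulN1r addNr.
move: (s - t) => {s t st} u u0.
have [n [a [b [ia ub]]]] := tensor_indep u; subst u.
rewrite big1 // => k _.
suff -> : b k = 0 by exact: tpure0r.
apply: e_inj; have e0 : e 0 = 0.
  by have := e_lin (-1) 0 0; rewrite scaleN1r oppr0 addr0 scaleN1r addNr.
rewrite e0; apply/funext => Y; apply: (ia (fun k => e (b k) Y)).
apply: OqP => X; have := u0 X Y; rewrite tpair_sum => h.
rewrite subval0E -[RHS]h subval_sumE.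
by apply: eq_bigr => i _; rewrite tpairE subvalZE mulrC.
Qed.
End Tpair.

Lemma ev_is_linear : linear (ev : OqGL -> dual).
Proof. by move=> c a b; apply/funext => X; rewrite evDE. Qed.

Lemma coprod_O (b : dual) : O b ->
  exists t : tensor O O, forall X Y, tpair (@subval _ _ O) t X Y = b (X * Y).
Proof.
have lin : linear (@subval _ _ O) := @subval_is_linear _ _ O.
elim/Oq_ind => [lam n rho f v h||c a a' [s hs] [t ht]].
- have oc f' v' : O (coef rho f' v').
    by apply: lspan_gen; exists lam, n, rho, f', v'.
  exists (\sum_j tpure (mksub (oc f (delta_mx j 0))) (mksub (oc (delta_mx 0 j) v))).
  move=> X Y; rewrite tpair_sum // /coef rmorphM -mulmxA mulmxA mxE.
  apply: eq_bigr => j _; rewrite tpairE //= /coef; congr (_ * _).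
    by rewrite mulmxA -colE mxE.
  by rewrite -rowE mxE.
- by exists 0 => X Y; rewrite tpair0.
- by exists (c *: s + t) => X Y; rewrite tpairD // hs ht.
Qed.

Lemma coprod_exists (b : OqGL) :
  exists t : tensor O OqGL, forall X Y, tpair ev t X Y = ev b (X * Y).
Proof.
have lin : linear (@subval _ _ O) := @subval_is_linear _ _ O.
have [t ht] := coprod_O (subvalP (subval b)).
have [n [a [c [ia tE]]]] := tensor_indep t; subst t.
have cB k : OqGL (c k).
  move=> Y UY; apply: OqP => Z; apply/eqP; rewrite -subr_eq0; apply/eqP.
  apply: (ia (fun k => subval (lact Y (c k)) Z - subval (counit Y *: c k) Z)).
  apply: OqP => X; rewrite subval_sumE subval0E.
  transitivity (ev b (X * (Z * Y)) - counit Y * ev b (X * Z)); last first.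
    by rewrite mulrA ev_Ul // subrr.
  rewrite /ev -!ht !tpair_sum // mulr_sumr -sumrB; apply: eq_bigr => i _.
  by rewrite !tpairE // !subvalZE lactE mulrBl mulrC; congr (_ - _); rewrite mulrC mulrCA.
exists (\sum_i tpure (a i) (mksub (cB i))) => X Y.
rewrite (tpair_sum ev_is_linear) [RHS]/ev -ht tpair_sum //; apply: eq_bigr => i _.
by rewrite (tpairE ev_is_linear) tpairE.
Qed.

Definition coprod (b : OqGL) : tensor O OqGL := sval (cid (coprod_exists b)).

Lemma coprodE b X Y : tpair ev (coprod b) X Y = ev b (X * Y).
Proof. by rewrite /coprod; case: cid => t /= ->. Qed.

Lemma coprod_is_linear : linear coprod.
Proof.
move=> c a b; apply: (tpair_inj ev_is_linear) => [a' b' h|X Y].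
  by apply: evP => X; rewrite h.
by rewrite (tpairD ev_is_linear) !coprodE evDE.
Qed.

HB.instance Definition _ :=
  GRing.isLinear.Build C OqGL (tensor O OqGL) _ coprod coprod_is_linear.
End FlagS.

(** * The (0,1)-Heckenberger-Kolb calculus of O_q(G/L_S), S = Pi \ {alpha_x} *)

Section Calculus.
Variable x : 'I_l.
Local Notation S := [set~ x].
Local Notation B := (OqGL S).
Local Notation K := (Ul S).

Lemma augB0 : counitO (subval (0 : B)) = 0.
Proof. exact: (@ev0 S 1). Qed.

Lemma augBP c (a b : B) : counitO (subval a) = 0 -> counitO (subval b) = 0 ->
  counitO (subval (c *: a + b)) = 0.
Proof. by move=> a0 b0; rewrite [LHS](evDE c a b 1) [ev a 1]a0 [ev b 1]b0 mulr0 addr0. Qed.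

(* B^+ *)
Definition augB : subspace B := Subspace augB0 augBP.

(* The functionals on B induced by the elements of U_q(l_S) E_x *)
Definition T01 (f : B -> C) : Prop :=
  exists2 Y, K Y & f = fun b => ev b (Y * uE D q x).

Definition annT01 (b : augB) : Prop := forall f, T01 f -> f (subval b) = 0.

Lemma annT01_0 : annT01 0.
Proof. by move=> _ [Y _ ->]; rewrite linear0 ev0. Qed.

Lemma annT01P c a b : annT01 a -> annT01 b -> annT01 (c *: a + b).
Proof.
move=> ha hb _ [Y UY ->]; rewrite subval_is_linear evDE.
have Tf : T01 (fun b => ev b (Y * uE D q x)) by exists Y.
by rewrite (ha _ Tf) (hb _ Tf) mulr0 addr0.
Qed.

(* I *)
Definition I01 : subspace augB := Subspace annT01_0 annT01P.

(* V = B^+ / I *)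
Definition V01 : lmodType C := quotsp I01.

(* The right action of K = U_q(l_S) on V *)
Lemma ract_aug Y (b : augB) : K Y -> augB (ractB Y (subval b)).
Proof.
move=> UY; have b0 : ev (subval b) 1 = 0 := subvalP b.
suff : ev (ractB Y (subval b)) 1 = 0 by [].
by rewrite ev_ractB mulr1 -[Y]mul1r ev_Ul // b0 mulr0.
Qed.

Definition ract_augB Y (UY : K Y) (b : augB) : augB := mksub (ract_aug b UY).

Lemma ev_ract_augB Y (UY : K Y) b X :
  ev (subval (ract_augB UY b)) X = ev (subval b) (Y * X).
Proof. by []. Qed.

Definition ractV Y (UY : K Y) : V01 -> V01 :=
  qlift (fun b => qclass I01 (ract_augB UY b)).

Lemma ract_augB_is_linear Y (UY : K Y) : linear (ract_augB UY).
Proof.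
move=> c a b; apply/subval_inj/evP => X.
by rewrite subval_is_linear evDE !ev_ract_augB subval_is_linear evDE.
Qed.
HB.instance Definition _ Y (UY : K Y) :=
  GRing.isLinear.Build C augB augB _ (ract_augB UY) (ract_augB_is_linear UY).

Lemma ract_I01 Y (UY : K Y) b : I01 b -> I01 (ract_augB UY b).
Proof.
move=> Ib _ [Z UZ ->]; rewrite ev_ract_augB mulrA.
by apply: (Ib (fun b => ev b (Y * Z * uE D q x))); exists (Y * Z) => //; apply: Ul_mul.
Qed.

Lemma ractVE Y (UY : K Y) b :
  ractV UY (qclass I01 b) = qclass I01 (ract_augB UY b).
Proof.
rewrite /ractV (qliftE (f := qclass I01 \o ract_augB UY)) //= => w Iw.
by rewrite -[0](linear0 (qclass I01)); apply/qclass_eq; rewrite subr0; apply: ract_I01.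
Qed.

Lemma ractV_is_linear Y (UY : K Y) : linear (ractV UY).
Proof.
move=> c; do 2![elim/qind=> ?].
by rewrite -linearP !ractVE -linearP -linearP.
Qed.
HB.instance Definition _ Y (UY : K Y) :=
  GRing.isLinear.Build C V01 V01 _ (ractV UY) (ractV_is_linear UY).

(* The K-balanced elements of O_q(G) (x) V *)
Definition is_balanced (w : tensor O V01) : Prop :=
  forall Y (UY : K Y), tmap (lact Y) idfun w = tmap idfun (ractV UY) w.

Lemma balanced0 : is_balanced 0.
Proof. by move=> Y UY; rewrite !linear0. Qed.

Lemma balancedP c v w : is_balanced v -> is_balanced w -> is_balanced (c *: v + w).
Proof. by move=> hv hw Y UY; rewrite !tmap_is_linear (hv Y UY) (hw Y UY). Qed.

Definition Omega01 : subspace (tensor O V01) := Subspace balanced0 balancedP.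

(* b |-> [b - epsilon(b) 1] *)
Lemma aug_proj_in (b : B) : augB (b - ev b 1 *: oneB S).
Proof.
suff : ev (b - ev b 1 *: oneB S) 1 = 0 by [].
rewrite addrC -scaleNr evDE.
have -> : ev (oneB S) 1 = 1 by rewrite /ev /= rmorph1.
by rewrite mulr1 addNr.
Qed.

Definition aug_proj (b : B) : augB := mksub (aug_proj_in b).

Lemma aug_projE b X : ev (subval (aug_proj b)) X = ev b X - ev b 1 * counit X.
Proof. by rewrite /= addrC -scaleNr evDE mulNr addrC. Qed.

Lemma aug_proj_is_linear : linear aug_proj.
Proof.
move=> c a b; apply/subval_inj/evP => X.
rewrite aug_projE [RHS](evDE c (subval (aug_proj a)) (subval (aug_proj b)) X).
rewrite !aug_projE !evDE.
by rewrite mulrBr mulrDl opprD addrACA mulrA.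
Qed.
HB.instance Definition _ := GRing.isLinear.Build C B augB _ aug_proj aug_proj_is_linear.

Definition classV (b : B) : V01 := qclass I01 (aug_proj b).
Lemma classV_is_linear : linear classV.
Proof. by move=> c a b; rewrite /classV aug_proj_is_linear qclass_is_linear. Qed.
HB.instance Definition _ := GRing.isLinear.Build C B V01 _ classV classV_is_linear.

Definition dbar_tensor (b : B) : tensor O V01 := tmap idfun classV (coprod b).

Lemma dbar_is_linear_aux : linear dbar_tensor.
Proof. by move=> c a b; rewrite /dbar_tensor coprod_is_linear tmap_is_linear. Qed.

Lemma dbar_balanced (b : B) : Omega01 (dbar_tensor b).
Proof.
move=> Y UY; rewrite /dbar_tensor.
have ractB_lin : linear (@ractB S Y).
  by move=> c a a'; apply: evP => X; rewrite evDE !ev_ractB evDE.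
pose rB : {linear B -> B} := HB.pack (@ractB S Y)
  (GRing.isLinear.Build C B B _ (@ractB S Y) ractB_lin).
have cl c : ractV UY (classV c) = classV (rB c).
  rewrite ractVE; congr (qclass _ _); apply/subval_inj/evP => X.
  rewrite aug_projE [LHS](aug_projE c (Y * X)) rmorphM.
  congr (_ - _); rewrite mulrA [_ * counit Y]mulrC; congr (_ * _).
  rewrite -(ev_Ul c 1 UY) mul1r.
  by have -> : ev (rB c) 1 = ev c (Y * 1) by []; rewrite mulr1.
have -> : tmap idfun (ractV UY) (tmap idfun classV (coprod b)) =
    tmap idfun classV (tmap idfun rB (coprod b)).
  elim/tensor_ind: (coprod b) => [|c v w t IH]; first by rewrite !linear0.
  by rewrite !tmap_is_linear IH !tmapE /= cl.
have -> : tmap (lact Y) idfun (tmap idfun classV (coprod b)) =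
    tmap idfun classV (tmap (lact Y) idfun (coprod b)).
  elim/tensor_ind: (coprod b) => [|c v w t IH]; first by rewrite !linear0.
  by rewrite !tmap_is_linear IH !tmapE.
congr (tmap _ _ _); apply: (tpair_inj (@ev_is_linear S)) => [a a' h|X Z].
  by apply: evP => X; rewrite h.
have pl (t : tensor O B) : tpair (@ev S) (tmap (lact Y) idfun t) X Z =
    tpair (@ev S) t (X * Y) Z.
  elim/tensor_ind: t => [|c v w t IH].
    by rewrite linear0 !(tpair0 (@ev_is_linear S)).
  by rewrite tmap_is_linear !(tpairD (@ev_is_linear S)) IH tmapE
    !(tpairE (@ev_is_linear S)) lactE.
have pr (t : tensor O B) : tpair (@ev S) (tmap idfun rB t) X Z =
    tpair (@ev S) t X (Y * Z).
  elim/tensor_ind: t => [|c v w t IH].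
    by rewrite linear0 !(tpair0 (@ev_is_linear S)).
  by rewrite tmap_is_linear !(tpairD (@ev_is_linear S)) IH tmapE
    !(tpairE (@ev_is_linear S)).
by rewrite pl pr !coprodE mulrA.
Qed.

(* dbar b = b_(1) (x) [b_(2) - epsilon(b_(2)) 1] *)
Definition dbar (b : B) : Omega01 := mksub (dbar_balanced b).

Lemma dbar_is_linear : linear dbar.
Proof.
move=> c a b; apply: subval_inj; rewrite subval_is_linear.
exact: dbar_is_linear_aux.
Qed.
HB.instance Definition _ := GRing.isLinear.Build C B Omega01 _ dbar dbar_is_linear.
End Calculus.
End Flag.

(* Main.v *)
From HB Require Import structures.
Require Import Defs.
From mathcomp Require Import all_boot all_order all_algebra.
From mathcomp Require Import all_classical all_reals.
From mathcomp Require Import complex ring.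
Import GRing.Theory.
Local Open Scope classical_set_scope.
Local Open Scope ring_scope.

(** An element b of the kernel is invariant under all of U_q(g), and invariance
    makes b a multiple of the counit: b(Y) = (Y |> b)(1) = epsilon(Y) b(1).

    The Levi part of the invariance is the definition of O_q(G/L_S). Invariance
    under E_x is what dbar b = 0 says once its second leg is paired with the
    functional E_x in T^(0,1) ([dbar_eq0_E]). Hence b is a highest weight vector
    of weight 0 for the left action, and only F_x remains.

    For F_x one argues with the copy of U_q(sl_2) attached to x. As b lies in
    a finite-dimensional module, K_x satisfies a polynomial identity on it
    ([Oq_annihilated]); the vectors F_x^n |> b are eigenvectors of K_x for
    pairwise distinct eigenvalues, so one of them is zero ([F_power_vanishes]).
    Since E_x F_x^(n+1) |> b is a nonzero multiple of F_x^n |> b for n > 0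
    ([E_Fexp]), the vanishing descends to F_x |> b = 0 ([highest_weight0_F]).
    That q is not a root of unity enters twice: the eigenvalues are distinct,
    and the multiples are nonzero. Conversely dbar 1 = 0 because the coproduct
    of 1 is 1 (x) 1 and the class of 1 in V^(0,1) is zero. *)

Section Invariants.
Variables (R : realType) (l : nat) (D : simple_datum l) (q : R).
Local Notation C := (R[i]).
Local Notation U := (Uq D q).

Lemma qC_expn_neq1 m : q <> -1 -> q <> 1 -> (0 < m)%N ->
  qC q ^+ (2 * m) != 1.
Proof.
move=> qN1 q1 m0; rewrite -[qC q ^+ _]rmorphXn /= -[1](rmorph1 (real_complex R)).
rewrite (inj_eq (fmorph_inj (real_complex R))) exprM.
rewrite Num.Theory.pexpr_eq1 ?Num.Theory.sqr_ge0 //.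
by rewrite sqrf_eq1 negb_or; apply/andP; split; apply/eqP.
Qed.

Lemma qi_expn_neq1 i m : q <> -1 -> q <> 1 -> (0 < m)%N ->
  qi D q i ^+ (2 * m) != 1.
Proof.
move=> qN1 q1 m0; rewrite /qi -exprM mulnCA; apply: qC_expn_neq1 => //.
by rewrite muln_gt0 half_sq_gt0.
Qed.

Lemma qi_neq0 i : q <> 0 -> qi D q i != 0.
Proof.
move=> q0; rewrite expf_neq0 //; apply/eqP => /(fmorph_inj (real_complex R)).
exact: q0.
Qed.

(** In each V_lambda the characteristic polynomial of K_i works, by
    Cayley-Hamilton; the product of two annihilating polynomials serves a sum of
    matrix coefficients. The factor Y makes the same polynomial annihilate every
    translate Y |> a. *)
Lemma Oq_annihilated i (a : U -> C^o) : Oq D q a ->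
  exists2 p : {poly C}, p != 0 &
    forall X Y : U, a (X * horner_alg (uK D q i) p * Y) = 0.
Proof.
elim/Oq_ind => [lam n rho f v _||c a1 a2 [p p0 hp] [r r0 hr]].
- exists (char_poly (rho (uK D q i))) => [|X Y].
    exact/monic_neq0/char_poly_monic.
  have rhoK p : rho (horner_alg (uK D q i) p) = horner_mx (rho (uK D q i)) p.
    elim/poly_ind: p => [|p c IH]; first by rewrite !rmorph0.
    rewrite !rmorphD !rmorphM /= IH horner_algX horner_algC horner_mx_X horner_mx_C.
    by rewrite linearZ rmorph1 -scalemx1.
  by rewrite /coef 2!rmorphM [X in _ * X * _](rhoK _) Cayley_Hamilton mulr0 mul0r
    mul0mx mulmx0 mxE.
- by exists 1 => //; exact: oner_neq0.
- exists (p * r) => [|X Y]; first by rewrite mulf_neq0.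
  rewrite dualE; have -> : a1 (X * horner_alg (uK D q i) (p * r) * Y) = 0.
    by rewrite rmorphM /= mulrA -[_ * _ * Y]mulrA; exact: hp.
  rewrite [p * r]mulrC rmorphM /= mulrA -[_ * _ * Y]mulrA mulr0 add0r; exact: hr.
Qed.

(** With z = c^n this is the induction step for the geometric sums that give
    (1 - c) c^n (sum over k <= n of c^k - c^-k) = (1 - c^(n+1)) (c^n - 1). *)
Lemma E_Fexp_scalar (F : fieldType) (c z s u v : F) : c != 0 -> z != 0 ->
  (1 - c) * z * u = s * (1 - c * z) * (z - 1) * v ->
  (1 - c) * (c * z) * (u + s * (c * z - (c * z)^-1) * v) =
  s * (1 - c * (c * z)) * (c * z - 1) * v.
Proof.
move=> c0 z0 uv; rewrite mulrDr.
have -> : (1 - c) * (c * z) * u = c * ((1 - c) * z * u) by ring.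
by rewrite uv; field; apply/andP.
Qed.

Section HighestWeightZero.
Variables (i : 'I_l) (a : {linear U -> C^o}).
Hypothesis aK : forall X, a (X * uK D q i) = a X.
Local Notation t := (qi D q i).
Local Notation c := (t ^- 2).

Lemma c_neq0 : q <> 0 -> c != 0.
Proof. by move=> q0; apply/invr_neq0/expf_neq0/qi_neq0. Qed.

Lemma K_mul_Fexp n : uK D q i * uF D q i ^+ n = c ^+ n *: (uF D q i ^+ n * uK D q i).
Proof.
elim: n => [|n IH]; first by rewrite !expr0 mulr1 mul1r scale1r.
rewrite exprS mulrA uKF cartan_diag -exprnN -scalerAl.
rewrite -[_ * uK _ _ _ * _]mulrA IH -scalerAr scalerA.
by rewrite [c ^+ n.+1]exprS mulrA.
Qed.

Lemma weight_K X n : a (X * uK D q i * uF D q i ^+ n) = c ^+ n * a (X * uF D q i ^+ n).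
Proof. by rewrite -mulrA K_mul_Fexp -scalerAr linearZ /= mulrA aK. Qed.

Lemma weight_KV X n : q <> 0 ->
  a (X * uKV D q i * uF D q i ^+ n) = (c ^+ n)^-1 * a (X * uF D q i ^+ n).
Proof.
move=> q0; have tn : c ^+ n != 0 by exact/expf_neq0/c_neq0.
apply: (mulfI tn); rewrite mulVKf // -weight_K.
by rewrite -(mulrA X) uKVK mulr1.
Qed.

Lemma weight_horner X n (p : {poly C}) :
  a (X * horner_alg (uK D q i) p * uF D q i ^+ n) = p.[c ^+ n] * a (X * uF D q i ^+ n).
Proof.
elim/poly_ind: p X => [|p d IH] X.
  by rewrite rmorph0 mulr0 mul0r linear0 horner0 mul0r.
rewrite rmorphD rmorphM /= horner_algX horner_algC mulrDr mulrDl linearD /=.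
rewrite mulrA weight_K IH hornerD hornerMX hornerC mulrDl [_ * c ^+ n]mulrC -mulrA.
by rewrite mulr_algl -scalerAr linearZ /= mulrA.
Qed.

Lemma F_power_vanishes : q <> -1 -> q <> 0 -> q <> 1 -> Oq D q a ->
  exists n, forall X, a (X * uF D q i ^+ n) = 0.
Proof.
move=> qN1 q0 q1 /(Oq_annihilated i)[p p0 hp].
have c_inj : injective (fun n => c ^+ n).
  suff c_lt m n : (m < n)%N -> c ^+ m <> c ^+ n.
    by move=> m n e; case: (ltngtP m n) => // /c_lt; rewrite e.
  move=> mn e; have := @qi_expn_neq1 i (n - m) qN1 q1.
  rewrite subn_gt0 => /(_ mn)/eqP; apply.
  have c0 := c_neq0 q0.
  move: e; rewrite -(subnK (ltnW mn)) exprD addnK -[LHS]mul1r.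
  move/(mulIf (expf_neq0 m c0)); rewrite exprVn -exprM => /(congr1 GRing.inv).
  by rewrite invr1 invrK.
(* A nonzero p has fewer than size p roots among the distinct c ^+ n. *)
have [n pn] : exists n, ~~ root p (c ^+ n).
  apply: contrapT => /forallNP hn.
  have rs : all (root p) [seq c ^+ n | n <- iota 0 (size p)].
    by apply/allP => _ /mapP[n _ ->]; apply: contrapT => /negP; exact: hn.
  have := max_poly_roots p0 rs.
  by rewrite size_map size_iota ltnn (map_inj_uniq c_inj) iota_uniq => /(_ isT).
exists n => X; have /eqP := hp X (uF D q i ^+ n).
by rewrite weight_horner mulf_eq0 -[p.[_] == 0]/(root p _) (negbTE pn) => /eqP.
Qed.

(** The classical E F^(n+1) v = - [n] [n+1] F^n v on a highest weight vector v
    of weight 0, cleared of denominators: by the commutation of E and F the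
    scalar is the sum over k <= n of (c^k - c^-k) / (t - t^-1). *)
Lemma E_Fexp X n : q <> 0 -> (forall X, a (X * uE D q i) = 0) ->
  (1 - c) * c ^+ n * a (X * uE D q i * uF D q i ^+ n.+1) =
  (t - t^-1)^-1 * (1 - c ^+ n.+1) * (c ^+ n - 1) * a (X * uF D q i ^+ n).
Proof.
move=> q0 aE; have c0 := c_neq0 q0.
have EF Y : uE D q i * uF D q i * Y =
    uF D q i * uE D q i * Y + (t - t^-1)^-1 *: (uK D q i * Y - uKV D q i * Y).
  have := uEF D q i i; rewrite eqxx mul1r => /eqP; rewrite subr_eq => /eqP ->.
  by rewrite mulrDl -scalerAl mulrBl addrC.
have step m Y : a (Y * uE D q i * uF D q i ^+ m.+1) =
    a (Y * uF D q i * uE D q i * uF D q i ^+ m)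
    + (t - t^-1)^-1 * (c ^+ m - (c ^+ m)^-1) * a (Y * uF D q i ^+ m).
  rewrite exprS -mulrA [uE _ _ _ * _]mulrA EF mulrDr linearD /= !mulrA; congr (_ + _).
  rewrite -scalerAr linearZ /= mulrBr linearB /= !mulrA weight_K weight_KV //.
  by rewrite -mulrBl -[RHS]mulrA.
elim: n X => [|n IH] X.
  by rewrite step expr0 !mulr1 aE invr1 !subrr !mulr0 !mul0r add0r mulr0.
rewrite step [c ^+ n.+2]exprS; have := IH (X * uF D q i).
rewrite -[X * _ * _ ^+ n]mulrA -exprS [c ^+ n.+1]exprS.
by apply: E_Fexp_scalar; rewrite ?expf_neq0.
Qed.

(** By descent on the least n with F^n |> a = 0: applying E to F^(n+1) |> a = 0
    shows F^n |> a = 0 as long as n > 0. *)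
Lemma highest_weight0_F : q <> -1 -> q <> 0 -> q <> 1 -> Oq D q a ->
  (forall X, a (X * uE D q i) = 0) -> forall X, a (X * uF D q i) = 0.
Proof.
move=> qN1 q0 q1 /F_power_vanishes -/(_ qN1 q0 q1)[n].
move=> + aE; elim: n => [|n IH] an X; first by have := an (X * uF D q i); rewrite mulr1.
case: n IH an => [_ an|n IH an]; first exact: an.
apply: IH => {}X; have := E_Fexp X n.+1 q0 aE.
have t0 := qi_neq0 i q0.
have cn m : (0 < m)%N -> c ^+ m - 1 != 0.
  move=> m0; rewrite subr_eq0 exprVn -exprM invr_eq1; exact: qi_expn_neq1.
have s0 : (t - t^-1)^-1 != 0.
  rewrite invr_neq0 // subr_eq0; apply: contra (qi_expn_neq1 i 1 qN1 q1 isT).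
  by move=> /eqP e; rewrite muln1 expr2 {2}e divff.
rewrite an mulr0 => /esym/eqP; rewrite !mulf_eq0 (negbTE s0) (negbTE (cn _ _)) //.
by rewrite -opprB oppr_eq0 (negbTE (cn _ _)) // => /eqP.
Qed.
End HighestWeightZero.

(** The Y with Y |> a = epsilon(Y) a form a subalgebra, which is everything as
    soon as it contains the generators; evaluating at 1 then gives a. *)
Lemma invariant_counit (a : {linear U -> C^o}) :
  (forall i X, a (X * uE D q i) = 0) -> (forall i X, a (X * uF D q i) = 0) ->
  (forall i X, a (X * uK D q i) = a X) ->
  forall Y, a Y = a 1 * counit Y.
Proof.
move=> aE aF aK; suff inv Y X : a (X * Y) = a X * counit Y.
  by move=> Y; rewrite -{1}[Y]mul1r inv.
elim/aind: Y X => s; elim: s => [[]i|||s IH|s IHs r IHr|k s IH|s IHs r IHr] X.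
- by rewrite -/(uE D q i) aE counitE mulr0.
- by rewrite -/(uF D q i) aF counitF mulr0.
- by rewrite -/(uK D q i) aK counitK mulr1.
- by rewrite -/(uKV D q i) -(aK i) -mulrA uKVK mulr1 counitKV mulr1.
- by rewrite aclass0 mulr0 !linear0 mulr0.
- by rewrite aclass1 mulr1 rmorph1 mulr1.
- by rewrite aclassN mulrN !linearN /= IH mulrN.
- by rewrite aclassD mulrDr !linearD /= IHs IHr mulrDr.
- by rewrite aclassZ -scalerAr !linearZ /= IH mulrCA.
- by rewrite aclassM mulrA IHr IHs rmorphM mulrA.
Qed.

Section Kernel.
Variable x : 'I_l.
Local Notation B := (OqGL D q [set~ x]%SET).

(** Evaluation at E_x belongs to T^(0,1), so it is well defined on V^(0,1);
    applied to the second leg of dbar b it yields E_x |> b. *)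
Lemma dbar_eq0_E (b : B) : dbar b = 0 -> forall X, ev b (X * uE D q x) = 0.
Proof.
move=> db X; have {}db : dbar_tensor b = 0 by rewrite -[LHS]/(subval (dbar b)) db linear0.
pose f (b : augB D q x) : C^o := ev (subval b) (uE D q x).
have f_lin : linear f by move=> c u v; rewrite /f subval_is_linear evDE.
pose fL : {linear augB D q x -> C^o} := HB.pack f (GRing.isLinear.Build C _ _ _ f f_lin).
have fI w : I01 D q x w -> fL w = 0.
  move=> Iw; rewrite /= /f -[uE D q x]mul1r.
  by apply: (Iw (fun b => ev b (1 * uE D q x))); exists 1 => //; exact: Ul_1.
(* e ignores its second argument: the pairing format of tpair wants a function
   on U_q(g), which is evaluated at the dummy point 1. *)
pose e (w : V01 D q x) : U -> C^o := fun=> qlift fL w.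
have e_lin : linear e.
  move=> c; do 2![elim/qind=> ?]; apply/funext => Y.
  by rewrite dualE /e -linearP !(qliftE _ fI) linearP.
have ev_lin := @ev_is_linear R l D q [set~ x]%SET.
have eE (t : tensor (Oq D q) B) :
    tpair e (tmap idfun (@classV R l D q x) t) X 1 = tpair (@ev R l D q _) t X (uE D q x).
  elim/tensor_ind: t => [|c v w t IH]; first by rewrite linear0 !tpair0.
  rewrite tmap_is_linear !tpairD // IH tmapE !tpairE //; congr (_ * (_ * _) + _).
  by rewrite /e (qliftE _ fI) /= /f aug_projE counitE mulr0 subr0.
have := eE (coprod b); rewrite coprodE => <-.
by rewrite -/(dbar_tensor b) db tpair0.
Qed.

Lemma dbar_oneB : dbar (oneB D q [set~ x]%SET) = 0.
Proof.
apply: subval_inj; rewrite linear0 -[LHS]/(dbar_tensor _) /dbar_tensor.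
have ev_lin := @ev_is_linear R l D q [set~ x]%SET.
have -> : coprod (oneB D q [set~ x]%SET) = tpure (oneO D q) (oneB D q _).
  apply: (tpair_inj ev_lin) => [a a' h|X Y]; first by apply: evP => X; rewrite h.
  by rewrite coprodE tpairE // -[LHS]/(counit (X * Y)) rmorphM.
rewrite tmapE /=; suff -> : classV (oneB D q [set~ x]%SET) = 0 by exact: tpure0r.
rewrite /classV; suff -> : aug_proj (oneB D q [set~ x]%SET) = 0 by exact: linear0.
apply/subval_inj/evP => X; rewrite aug_projE linear0 ev0.
by rewrite -[ev _ 1]/(counit 1) rmorph1 mul1r subrr.
Qed.
End Kernel.
End Invariants.

Theorem theorem4p4 (R : realType) (l : nat) (D : simple_datum l) (q : R)
    (hqN1 : q <> -1) (hq0 : q <> 0) (hq1 : q <> 1)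
    (x : 'I_l) (hx : irreducible_node D x) :
  [set b : OqGL D q [set~ x]%SET | dbar b = 0]
  = range (fun c : R[i] => c *: oneB D q [set~ x]%SET).
Proof.
apply/seteqP; split=> [b /= db|_ [c _ <-]] /=; last by rewrite linearZ /= dbar_oneB scaler0.
have ba := subvalP (subval b).
pose f : Uq D q -> R[i]^o := ev b.
pose a : {linear Uq D q -> R[i]^o} :=
  HB.pack f (GRing.isLinear.Build R[i] (Uq D q) R[i]^o _ f (Oq_linear ba)).
have aK i X : a (X * uK D q i) = a X.
  by rewrite -[LHS]/(ev b _) (ev_Ul b X (Ul_K D q _ i)) counitK mul1r.
have aE i X : a (X * uE D q i) = 0.
  have [->|ix] := eqVneq i x; first exact: dbar_eq0_E.
  have iS : i \in [set~ x]%SET by rewrite !inE.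
  by rewrite -[LHS]/(ev b _) (ev_Ul b X (Ul_E D q iS)) counitE mul0r.
have aF i X : a (X * uF D q i) = 0 by apply: highest_weight0_F.
exists (ev b 1) => //; apply: evP => X.
rewrite -[RHS]/(a X) (invariant_counit _ _ _ _ a aE aF aK).
by rewrite -[_ *: _]addr0 evDE ev0 addr0.
Qed.
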